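(* For every $k \ge 3$ there exists an embedding (injective group homomorphism) $\iota: G_{2,1} \hookrightarrow G_{k,1}(0,1|2|\ldots|k-1)$.
   Context: For an integer $k \ge 2$ let $A = A_k = \{a_0, a_1, \ldots, a_{k-1}\}$ be an alphabet with $k$ letters, and let $A^*$ be the set of all finite strings over $A$ (including the empty string). For $x, p \in A^*$, $p$ is a prefix of $x$ iff $x = pu$ for some $u \in A^*$. A prefix code is a set $P \subset A^*$ in which no element is a prefix of a different element; it is maximal if it is not a strict subset of any other prefix code of $A^*$. A right ideal of $A^*$ is a set $R \subseteq A^*$ with $R = R A^*$. Every finitely generated right ideal is generated by a unique finite prefix code. ''Function'' means partial function. A right ideal morphism of $A^*$ is a partial function $f: A^* \to A^*$ such that for all $x \in \mathrm{Dom}(f)$ and all $w \in A^*$: $xw \in \mathrm{Dom}(f)$ and $f(xw) = f(x)\,w$. Then $\mathrm{Dom}(f)$ and $\mathrm{Im}(f)$ are right ideals; the prefix codes generating them are denoted $\mathrm{domC}(f)$ and $\mathrm{imC}(f)$. Let $\mathcal{RI}_k^{\mathsf{fin}}$ be the set of all injective right ideal morphisms $f$ of $A_k^*$ such that $\mathrm{domC}(f)$ and $\mathrm{imC}(f)$ are finite maximal prefix codes. Every $f \in \mathcal{RI}_k^{\mathsf{fin}}$ is contained (as a set of pairs) in a unique $\subseteq$-maximum right ideal morphism in $\mathcal{RI}_k^{\mathsf{fin}}$, called the maximum extension of $f$. The Higman-Thompson group $G_{k,1}$ consists, as a set, of those $f \in \mathcal{RI}_k^{\mathsf{fin}}$ that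 are maximum extensions (i.e., equal to their own maximum extension); the multiplication is composition of partial functions followed by maximum extension. With this multiplication $G_{k,1}$ is a group. The subgroup $G_{k,1}(0,1|2|\ldots|k-1)$ of $G_{k,1}$ is the set of all $g \in G_{k,1}$ such that (1) $\mathrm{domC}(g) \cup \mathrm{imC}(g) \subset \{a_0,a_1\}^* \cup \bigcup_{i=1}^{k-1} \{a_0,a_1\}^* a_i$; and (2) for all $x \in \mathrm{Dom}(g)$: $x \in \{a_0,a_1\}^* \Leftrightarrow g(x) \in \{a_0,a_1\}^*$, and for all $i = 2, \ldots, k-1$: $x \in \{a_0,a_1\}^* a_i \Leftrightarrow g(x) \in \{a_0,a_1\}^* a_i$. *)

(* Defs.v *)
From HB Require Import structures.
From mathcomp Require Import all_boot.
From mathcomp Require Import boolp classical_sets functions cardinality.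

Set Implicit Arguments.
Unset Strict Implicit.
Unset Printing Implicit Defensive.

Local Open Scope classical_set_scope.

(* The letter a_i of A_k is the ordinal i : 'I_k, strings are sequences of
   letters, and a partial function A_k^* -> A_k^* takes the value None outside
   its domain. The Higman-Thompson group is defined below for every k, but the
   intended range is k >= 2. *)
Notation word k := (seq 'I_k).
Notation pfun k := (word k -> option (word k)).

Section Codes.
Variable k : nat.
Implicit Types (P Q R : set (word k)) (p q u v w x y : word k).

Definition prefix_code P := forall p q, P p -> P q -> prefix p q -> p = q.

Definition maximal_prefix_code P :=
  prefix_code P /\ forall Q, prefix_code Q -> ~ P `<` Q.

Definition ideal_of P : set (word k) := [set x ++ w | x in P & w in setT].

Definition right_ideal R := R = ideal_of R.

(* The prefix code that generates R; see ideal_codeP. *)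
Definition ideal_code R : set (word k) :=
  [set x | R x /\ forall p, R p -> prefix p x -> p = x].

Lemma right_idealP R : right_ideal R <-> forall x w, R x -> R (x ++ w).
Proof.
split=> [-> x w [x1 Rx1 [w1 _ <-]]|H].
  by exists x1 => //; exists (w1 ++ w) => //; rewrite catA.
rewrite /right_ideal eqEsubset; split=> x.
  by move=> Rx; exists x => //; exists [::]; rewrite ?cats0.
by move=> [y Ry [w _ <-]]; exact: H.
Qed.

Lemma prefix_comparable p x w : prefix p (x ++ w) -> prefix p x \/ prefix x p.
Proof.
rewrite prefixE => /eqP <-; rewrite take_cat.
by case: ltnP => _; [left; exact: prefix_take|right; exact: prefix_prefix].
Qed.

Lemma ideal_code_prefix R x : R x -> exists2 p, ideal_code R p & prefix p x.
Proof.
move: {2}(size x) (leqnn (size x)) => n; elim: n x => [|n IH] x sx Rx.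
  exists x; rewrite ?prefix_refl //; split=> // p _ /prefixP[s E].
  by move: sx; rewrite E leqn0 size_eq0; case: p {E} => //; case: s.
have [[p [Rp [pfx pneq]]]|H] :=
    pselect (exists p, R p /\ (prefix p x /\ p <> x)); last first.
  exists x; rewrite ?prefix_refl //; split=> // p Rp pfx.
  by apply: contrapT => pneq; apply: H; exists p.
have [|q Cq qp] := IH p _ Rp; last by exists q => //; exact: prefix_trans pfx.
move: pfx sx => /prefixP[[|a s] E]; first by case: pneq; rewrite E cats0.
by rewrite E size_cat /= addnS ltnS => /(leq_trans (leq_addr _ _)).
Qed.

Lemma ideal_code_prefix_code R : prefix_code (ideal_code R).
Proof. by move=> p q [Rp _] [_ H] pq; exact: H. Qed.

Lemma ideal_codeP R P : right_ideal R ->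
  (prefix_code P /\ ideal_of P = R) <-> P = ideal_code R.
Proof.
move=> Rid; split=> [[PP PR]|->].
  have subR x : P x -> R x.
    by move=> Px; rewrite -PR; exists x => //; exists [::]; rewrite ?cats0.
  rewrite eqEsubset; split=> x.
    move=> Px; split=> [|p]; first exact: subR.
    rewrite -PR => -[q Pq [w _ <-]] pfx.
    have qx : q = x by apply: PP => //; apply: prefix_trans pfx; rewrite prefix_prefix.
    move: pfx => /prefixP[s]; rewrite -qx -catA -{1}[q]cats0 => /eqP.
    by rewrite eqseq_cat // eqxx; case: w => // _; rewrite cats0.
  move=> [+ H]; rewrite -PR => -[p Pp [w _ E]].
  by rewrite -(H p) ?E //; [exact: subR|rewrite -E prefix_prefix].
split; first exact: ideal_code_prefix_code.
rewrite eqEsubset; split=> x.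
  by move=> [y [Ry _] [w _ <-]]; move/right_idealP: Rid; apply.
by move=> /ideal_code_prefix[p Cp /prefixP[s ->]]; exists p => //; exists s.
Qed.

Definition cofinal R := (exists n, forall x, n <= size x -> R x) /\ R !=set0.

Lemma long_word n x y : x = y \/ exists w, n <= size w.
Proof.
case: x y => [|a x] [|b y]; first by left.
- by right; exists (nseq n b); rewrite size_nseq.
- by right; exists (nseq n a); rewrite size_nseq.
- by right; exists (nseq n a); rewrite size_nseq.
Qed.

Lemma cofinal_ext R x : cofinal R -> exists w, R (x ++ w).
Proof.
move=> [[n Rn] [y Ry]]; have [->|[w nw]] := long_word n x y.
  by exists [::]; rewrite cats0.
by exists w; apply: Rn; rewrite size_cat (leq_trans nw) // leq_addl.
Qed.

Lemma finite_words n : finite_set [set x : word k | size x <= n].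
Proof.
elim: n => [|n IH].
  by apply: (sub_finite_set (B := [set [::]])) => // -[|//].
apply: (sub_finite_set (B := [set [::]] `|`
  [set (fun p : 'I_k * word k => p.1 :: p.2) p |
     p in [set: 'I_k] `*` [set x : word k | size x <= n]])).
  by move=> [|a x] /=; [left|rewrite ltnS => sx; right; exists (a, x)].
rewrite finite_setU; split=> //; apply: finite_image.
by apply: finite_setX => //; exact: finite_finset.
Qed.

Lemma maximal_codeP R : right_ideal R ->
  (finite_set (ideal_code R) /\ maximal_prefix_code (ideal_code R))
  <-> cofinal R.
Proof.
move=> /right_idealP Rid; split=> [[/finite_seqP[s Es] [PC PM]]|big].
  have key x : (forall p, ideal_code R p -> ~~ prefix p x /\ ~~ prefix x p) ->
      False.
    move=> H; apply: (PM (ideal_code R `|` [set x])).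
      move=> p q [Cp|->] [Cq|->] //; first exact: PC.
        by move=> E; have [] := H _ Cp; rewrite E.
      by move=> E; have [_] := H _ Cq; rewrite E.
    split; first by left.
    move=> /(_ x (or_intror erefl))/H[]; by rewrite prefix_refl.
  split.
    exists (\max_(p <- s) size p).+1 => x sx; apply: contrapT => nRx.
    apply: (key x) => p Cp; split; apply/negP.
      by move=> /prefixP[w E]; apply: nRx; rewrite E; apply: Rid; case: Cp.
    move=> /size_prefix; apply/negP; rewrite -ltnNge (leq_trans _ sx) // ltnS.
    by apply: leq_bigmax_seq => //; move: Cp; rewrite Es.
  apply: contrapT => R0; apply: (key [::]) => p [Rp _].
  by case: R0; exists p.
have Cle n : (forall x, n <= size x -> R x) ->
    ideal_code R `<=` [set x | size x <= n].
  move=> Rn x [Rx H]; rewrite /= leqNgt; apply/negP => nx.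
  have sz : size (take n x) = n by rewrite size_takel // ltnW.
  have := H (take n x) (Rn _ _); rewrite sz leqnn => /(_ isT).
  rewrite -{2}(cat_take_drop n x) prefix_prefix => /(_ isT) E.
  by move: nx; rewrite -E sz ltnn.
split.
  have [[n /Cle Cn] _] := big.
  exact: (sub_finite_set Cn (finite_words n)).
split; first exact: ideal_code_prefix_code.
move=> Q QP [CQ]; apply=> x Qx.
have [w /ideal_code_prefix[p Cp]] := cofinal_ext x big => /prefix_comparable.
by case=> [/(QP _ _ (CQ _ Cp) Qx) <-|/(QP _ _ Qx (CQ _ Cp)) ->].
Qed.

End Codes.

Section PartialFunctions.
Variable k : nat.
Implicit Types (f g h F : pfun k) (u v w x y : word k).

Definition Dom f : set (word k) := [set x | exists y, f x = Some y].
Definition Im f : set (word k) := [set y | exists x, f x = Some y].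

Definition right_ideal_morphism f :=
  forall x y, f x = Some y -> forall w, f (x ++ w) = Some (y ++ w).

Definition pinjective f :=
  forall x1 x2 y, f x1 = Some y -> f x2 = Some y -> x1 = x2.

Definition domC f := ideal_code (Dom f).
Definition imC f := ideal_code (Im f).

Definition RIfin f :=
  [/\ right_ideal_morphism f, pinjective f,
      finite_set (domC f) /\ maximal_prefix_code (domC f) &
      finite_set (imC f) /\ maximal_prefix_code (imC f)].

Definition contained f g := forall x y, f x = Some y -> g x = Some y.

Definition is_maximum_extension f F :=
  [/\ RIfin F, contained f F &
      forall g, RIfin g -> contained f g -> contained g F].

(* Junk value f when f has no maximum extension, which does not happen for f
   in RIfin (see maximum_extensionP). *)
Definition maximum_extension f : pfun k := xget f (is_maximum_extension f).

Definition pcomp f g : pfun k := fun x => obind f (g x).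

Definition pinv f : pfun k :=
  fun y => if pselect (exists x, f x = Some y) is left e
           then Some (projT1 (cid e)) else None.

Lemma pfun_ext f g : (forall x y, f x = Some y <-> g x = Some y) -> f = g.
Proof.
move=> H; apply: funext => x; case E: (f x) => [y|].
  by move/H: E => ->.
by case E': (g x) => [y|] //; move/H: E'; rewrite E.
Qed.

Lemma contained_anti f g : contained f g -> contained g f -> f = g.
Proof. by move=> fg gf; apply: pfun_ext => x y; split; [exact: fg|exact: gf]. Qed.

Lemma Dom_ideal f : right_ideal_morphism f -> right_ideal (Dom f).
Proof.
by move=> fM; apply/right_idealP => x w [y /fM H]; exists (y ++ w); exact: H.
Qed.

Lemma Im_ideal f : right_ideal_morphism f -> right_ideal (Im f).
Proof.
by move=> fM; apply/right_idealP => y w [x /fM H]; exists (x ++ w); exact: H.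
Qed.

Lemma RIfinP f : RIfin f <->
  [/\ right_ideal_morphism f, pinjective f, cofinal (Dom f) & cofinal (Im f)].
Proof.
split=> -[fM fI fD fR]; split=> //.
- by apply/maximal_codeP => //; exact: Dom_ideal.
- by apply/maximal_codeP => //; exact: Im_ideal.
- by apply/maximal_codeP => //; exact: Dom_ideal.
- by apply/maximal_codeP => //; exact: Im_ideal.
Qed.

Definition eventually f x y :=
  exists n, forall w, n <= size w -> f (x ++ w) = Some (y ++ w).

Lemma catIw w x y : x ++ w = y ++ w -> x = y.
Proof.
move=> E; have sz : size x = size y.
  by move/(congr1 size): E; rewrite !size_cat => /addIn.
by move/eqP: E; rewrite eqseq_cat // => /andP[/eqP].
Qed.

Lemma eventually_fun f x y1 y2 :
  eventually f x y1 -> eventually f x y2 -> y1 = y2.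
Proof.
move=> [n1 H1] [n2 H2]; have [//|[w]] := long_word (maxn n1 n2) y1 y2.
by rewrite geq_max => /andP[/H1 E1 /H2]; rewrite E1 => -[] /catIw.
Qed.

Let extension f : pfun k :=
  fun x => if pselect (exists y, eventually f x y) is left e
           then Some (projT1 (cid e)) else None.

Let extensionE f x y : extension f x = Some y <-> eventually f x y.
Proof.
rewrite /extension; case: pselect => [e|ne].
  case: cid => z /= fz; split=> [[<-] //|fy].
  by rewrite (eventually_fun fz fy).
by split=> // fy; case: ne; exists y.
Qed.

Lemma eventually_contained f x y :
  right_ideal_morphism f -> f x = Some y -> eventually f x y.
Proof. by move=> fM fx; exists 0 => w _; exact: fM. Qed.

Let extensionP f : RIfin f -> is_maximum_extension f (extension f).
Proof.
move=> /[dup] fR /RIfinP[fM fI [[n fD] [x0 Dx0]] [[m fR'] [y0 Ry0]]].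
have sub : contained f (extension f).
  by move=> x y fx; apply/extensionE; exact: eventually_contained.
split=> //.
  apply/RIfinP; split.
  - move=> x y /extensionE[l H] w; apply/extensionE; exists l => v lv.
    by rewrite -!catA; apply: H; rewrite size_cat (leq_trans lv) // leq_addl.
  - move=> x1 x2 y /extensionE[l1 H1] /extensionE[l2 H2].
    have [//|[w]] := long_word (maxn l1 l2) x1 x2.
    by rewrite geq_max => /andP[/H1 E1 /H2 /(fI _ _ _ E1)/catIw].
  - split; last by have [y /sub] := Dx0; exists x0, y.
    by exists n => x /fD[y /sub]; exists y.
  - split; last by have [x /sub] := Ry0; exists y0, x.
    by exists m => y /fR'[x /sub]; exists x.
move=> g /RIfinP[gM _ _ _] fg x y /gM gx; apply/extensionE; exists n => w nw.
have [|z fz] := fD (x ++ w).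
  by rewrite size_cat (leq_trans nw) // leq_addl.
by move/fg: (fz); rewrite gx fz.
Qed.

Lemma maximum_extensionP f :
  RIfin f -> is_maximum_extension f (maximum_extension f).
Proof. by move=> fR; apply: (xgetI f (extensionP fR)). Qed.

Lemma maximum_extension_unique f F1 F2 :
  is_maximum_extension f F1 -> is_maximum_extension f F2 -> F1 = F2.
Proof.
by move=> [R1 c1 m1] [R2 c2 m2]; apply: contained_anti; [exact: m2|exact: m1].
Qed.

Lemma maximum_extensionE f x y :
  RIfin f -> maximum_extension f x = Some y <-> eventually f x y.
Proof.
move=> fR; rewrite -extensionE.
by rewrite (maximum_extension_unique (maximum_extensionP fR) (extensionP fR)).
Qed.

Lemma maximum_extension_RIfin f : RIfin f -> RIfin (maximum_extension f).
Proof. by case/maximum_extensionP. Qed.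

Definition agree f g := exists n, forall w, n <= size w -> f w = g w.

Lemma agree_sym f g : agree f g -> agree g f.
Proof. by move=> [n H]; exists n => w /H. Qed.

Lemma agree_trans f g h : agree f g -> agree g h -> agree f h.
Proof.
move=> [n1 H1] [n2 H2]; exists (maxn n1 n2) => w.
by rewrite geq_max => /andP[/H1 -> /H2].
Qed.

Lemma eventually_agree f g x y : agree f g -> eventually f x y -> eventually g x y.
Proof.
move=> [n fg] [m fxy]; exists (maxn n m) => w.
rewrite geq_max => /andP[nw /fxy <-]; rewrite fg //.
by rewrite size_cat (leq_trans nw) // leq_addl.
Qed.

Lemma maximum_extension_agree f g : RIfin f -> RIfin g -> agree f g ->
  maximum_extension f = maximum_extension g.
Proof.
move=> fR gR fg; apply: pfun_ext => x y; rewrite !maximum_extensionE //.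
by split; apply: eventually_agree => //; exact: agree_sym.
Qed.

Lemma agree_maximum_extension f : RIfin f -> agree (maximum_extension f) f.
Proof.
move=> fR; have [_ sub _] := maximum_extensionP fR.
have /RIfinP[_ _ [[n fD] _] _] := fR.
by exists n => w /fD[y fw]; rewrite fw; exact: sub.
Qed.

Lemma maximum_extension_id f : RIfin f ->
  maximum_extension (maximum_extension f) = maximum_extension f.
Proof.
move=> fR; apply: maximum_extension_agree => //.
  exact: maximum_extension_RIfin.
exact: agree_maximum_extension.
Qed.

Lemma pcompE f g x z :
  pcomp f g x = Some z <-> exists2 y, g x = Some y & f y = Some z.
Proof.
rewrite /pcomp; case: (g x) => [y|] /=; last by split=> // -[].
by split=> [fy|[_ [<-]]] //; exists y.
Qed.

Lemma pcompA f g h : pcomp (pcomp f g) h = pcomp f (pcomp g h).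
Proof. by apply: funext => x; rewrite /pcomp; case: (h x). Qed.

Lemma rim_long g n : right_ideal_morphism g -> cofinal (Dom g) ->
  exists m, forall x, m <= size x -> exists2 y, g x = Some y & n <= size y.
Proof.
move=> gM [[l gD] _]; exists (l + n) => x sx.
have [|y gy] := gD (take l x); first by rewrite size_takel // (leq_trans _ sx) ?leq_addr.
exists (y ++ drop l x); first by rewrite -{1}(cat_take_drop l x); exact: gM.
by rewrite size_cat size_drop (leq_trans _ (leq_addl _ _)) // leq_subRL // (leq_trans _ sx) ?leq_addr.
Qed.

Lemma pinvE f x y : pinjective f -> pinv f y = Some x <-> f x = Some y.
Proof.
move=> fI; rewrite /pinv; case: pselect => [e|ne].
  case: cid => z /= fz; split=> [[<-] //|fx].
  by rewrite (fI _ _ _ fz fx).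
by split=> // fx; case: ne; exists x.
Qed.

Lemma pinv_RIfin f : RIfin f -> RIfin (pinv f).
Proof.
move=> /RIfinP[fM fI fD fR]; apply/RIfinP; split.
- by move=> y x /pinvE-/(_ fI)/fM fx w; apply/pinvE.
- move=> y1 y2 x /pinvE-/(_ fI) E1 /pinvE-/(_ fI) E2.
  by move: E1; rewrite E2 => -[].
- have -> // : Dom (pinv f) = Im f.
  by rewrite eqEsubset; split=> y [x H]; exists x; [exact/(pinvE _ _ fI)|exact/pinvE].
- have -> // : Im (pinv f) = Dom f.
  by rewrite eqEsubset; split=> x [y H]; exists y; [exact/(pinvE _ _ fI)|exact/pinvE].
Qed.

Lemma cofinal_pcomp_Dom f g : right_ideal_morphism f -> cofinal (Dom f) ->
  right_ideal_morphism g -> cofinal (Dom g) -> cofinal (Dom (pcomp f g)).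
Proof.
move=> fM fD gM gD; split.
  have [[n fDn] _] := fD; have [m H] := rim_long n gM gD.
  exists m => x /H[y gx /fDn[z fy]].
  by exists z; apply/pcompE; exists y.
have [_ [x [y gx]]] := gD; have [w [z fy]] := cofinal_ext y fD.
by exists (x ++ w), z; apply/pcompE; exists (y ++ w) => //; exact: gM.
Qed.

Lemma pcomp_RIfin f g : RIfin f -> RIfin g -> RIfin (pcomp f g).
Proof.
move=> /[dup] /pinv_RIfin/RIfinP[f'M f'I f'D _] /RIfinP[fM fI fD fR].
move=> /[dup] /pinv_RIfin/RIfinP[g'M g'I g'D _] /RIfinP[gM gI gD gR].
apply/RIfinP; split.
- move=> x z /pcompE[y gx fy] w.
  by apply/pcompE; exists (y ++ w); [exact: gM|exact: fM].
- move=> x1 x2 z /pcompE[y1 g1 f1] /pcompE[y2 g2 f2].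
  by move: g1; rewrite (fI _ _ _ f1 f2) => /gI/(_ g2).
- exact: cofinal_pcomp_Dom.
- have -> : Im (pcomp f g) = Dom (pcomp (pinv g) (pinv f)); last first.
    exact: cofinal_pcomp_Dom.
  rewrite eqEsubset; split=> z [x /pcompE[y E1 E2]]; exists x.
    by apply/pcompE; exists y; apply/pinvE.
  by apply/pcompE; exists y; [move/pinvE: E2; exact|move/pinvE: E1; exact].
Qed.

Lemma Some_RIfin : RIfin (Some : pfun k).
Proof.
have H : cofinal [set: word k] by split; [exists 0|exists [::]].
apply/RIfinP; split.
- by move=> x _ [<-].
- by move=> x1 x2 y [->] [->].
- by have -> // : Dom (Some : pfun k) = setT; rewrite -subTset => x _; exists x.
- by have -> // : Im (Some : pfun k) = setT; rewrite -subTset => x _; exists x.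
Qed.

Lemma maximum_extension_Some : maximum_extension Some = Some :> pfun k.
Proof.
apply: pfun_ext => x y; rewrite maximum_extensionE; last exact: Some_RIfin.
split=> [[n H]|[<-]]; last by exists 0.
have [<- //|[w /H[]/catIw<-//]] := long_word n x y.
Qed.

Lemma agree_pcomp f1 f2 g1 g2 : RIfin g1 -> agree f1 f2 -> agree g1 g2 ->
  agree (pcomp f1 g1) (pcomp f2 g2).
Proof.
move=> /RIfinP[gM _ gD _] [n ff] [m gg]; have [l H] := rim_long n gM gD.
exists (maxn m l) => w; rewrite geq_max => /andP[mw /H[y gy ny]].
by rewrite /pcomp -gg // gy /= ff.
Qed.

Lemma agree_pinv_l f : RIfin f -> agree (pcomp (pinv f) f) Some.
Proof.
move=> /RIfinP[_ fI [[n fD] _] _]; exists n => w /fD[y fw].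
by apply/pcompE; exists y => //; exact/pinvE.
Qed.

Lemma agree_pinv_r f : RIfin f -> agree (pcomp f (pinv f)) Some.
Proof.
move=> /RIfinP[_ fI _ [[n fD] _]]; exists n => w /fD[y fw].
by apply/pcompE; exists y => //; exact/pinvE.
Qed.

End PartialFunctions.

Section HigmanThompson.
Variable k : nat.

(* The Higman-Thompson group G_{k,1}. *)
Record HT := MkHT {
  HT_fun :> pfun k;
  HT_funP : `[< RIfin HT_fun /\ maximum_extension HT_fun = HT_fun >]
}.

HB.instance Definition _ := [isSub for HT_fun].
HB.instance Definition _ := [Choice of HT by <:].

Implicit Types f g h : HT.

Lemma HT_RIfin f : RIfin f.
Proof. by have /asboolP[] := HT_funP f. Qed.

Lemma HT_max f : maximum_extension f = f :> pfun k.
Proof. by have /asboolP[] := HT_funP f. Qed.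

Lemma HT_eq f g : agree f g -> f = g.
Proof.
move=> fg; apply: val_inj; rewrite /= -HT_max -[RHS]HT_max.
by apply: maximum_extension_agree => //; exact: HT_RIfin.
Qed.

Lemma maximum_extension_HT (f : pfun k) : RIfin f ->
  `[< RIfin (maximum_extension f) /\
      maximum_extension (maximum_extension f) = maximum_extension f >].
Proof.
move=> fR; apply/asboolP; split; last exact: maximum_extension_id.
exact: maximum_extension_RIfin.
Qed.

Definition HT_mul f g : HT :=
  MkHT (maximum_extension_HT (pcomp_RIfin (HT_RIfin f) (HT_RIfin g))).

Definition HT_inv f : HT :=
  MkHT (maximum_extension_HT (pinv_RIfin (HT_RIfin f))).

Definition HT_one : HT :=
  MkHT (asboolT (conj (@Some_RIfin k) (@maximum_extension_Some k))).

Let agree_mul f g : agree (HT_mul f g) (pcomp f g).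
Proof. by apply: agree_maximum_extension; apply: pcomp_RIfin; exact: HT_RIfin. Qed.

Let agree_inv f : agree (HT_inv f) (pinv f).
Proof. by apply: agree_maximum_extension; apply: pinv_RIfin; exact: HT_RIfin. Qed.

Let agree_refl (f : pfun k) : agree f f. Proof. by exists 0. Qed.

Let mulA : associative HT_mul.
Proof.
move=> f g h; apply: HT_eq; apply: (agree_trans (agree_mul _ _)).
apply: agree_sym; apply: (agree_trans (agree_mul _ _)).
apply: (agree_trans (agree_pcomp (HT_RIfin h) (agree_mul f g) (agree_refl h))).
rewrite pcompA; apply: agree_pcomp => //; last exact/agree_sym/agree_mul.
by apply: pcomp_RIfin; exact: HT_RIfin.
Qed.

Let mul1 : left_id HT_one HT_mul.
Proof.
move=> f; apply: HT_eq; apply: (agree_trans (agree_mul _ _)).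
by exists 0 => w _; rewrite /pcomp /=; case: (f w).
Qed.

Let mulf1 : right_id HT_one HT_mul.
Proof. by move=> f; apply: HT_eq; exact: (agree_trans (agree_mul _ _)). Qed.

Let mulV : left_inverse HT_one HT_inv HT_mul.
Proof.
move=> f; apply: HT_eq; apply: (agree_trans (agree_mul _ _)).
apply: agree_trans (agree_pinv_l (HT_RIfin f)).
by apply: agree_pcomp => //; exact: HT_RIfin.
Qed.

Let mulfV : right_inverse HT_one HT_inv HT_mul.
Proof.
move=> f; apply: HT_eq; apply: (agree_trans (agree_mul _ _)).
apply: agree_trans (agree_pinv_r (HT_RIfin f)).
by apply: agree_pcomp => //; exact: HT_RIfin.
Qed.

HB.instance Definition _ := isGroup.Build HT mulA mul1 mulf1 mulV mulfV.

Lemma HT_mulE f g : (f * g)%g = maximum_extension (pcomp f g) :> pfun k.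
Proof. by []. Qed.

End HigmanThompson.

Section Subgroup.
Variable k : nat.
Implicit Types (f g : pfun k) (u v w x y : word k) (a : 'I_k).

(* {a_0,a_1}^* and {a_0,a_1}^* a. *)
Definition binary : set (word k) := [set x | all (fun a : 'I_k => a < 2) x].
Definition binary_then a : set (word k) := [set rcons u a | u in binary].

Definition separating g :=
  domC g `|` imC g `<=`
    binary `|` \bigcup_(a in [set a : 'I_k | 1 <= a]) binary_then a /\
  forall x y, g x = Some y ->
    (binary x <-> binary y) /\
    forall a, 2 <= a -> (binary_then a x <-> binary_then a y).

Lemma binary_cat x y : binary (x ++ y) <-> binary x /\ binary y.
Proof. by rewrite /binary /= all_cat; split=> [/andP[]|[-> ->]]. Qed.

Lemma binary_thenP a x : 2 <= a -> binary_then a x -> ~ binary x.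
Proof.
by move=> a2 [u _ <-]; rewrite -cats1 => /binary_cat[_]; rewrite /binary /= ltnNge a2.
Qed.

Lemma not_binary x : ~ binary x ->
  exists u a v, [/\ 2 <= a, binary u & x = rcons u a ++ v].
Proof.
elim: x => [[]//|b x IH]; rewrite /binary /=; case: ltnP => b2 /= bx.
  have [u [a [v [a2 bu ->]]]] := IH bx.
  by exists (b :: u), a, v; split=> //; rewrite /binary /= b2.
by exists [::], b, x.
Qed.

Lemma ideal_code_binary (R : set (word k)) : right_ideal R -> cofinal R ->
  (ideal_code R `<=`
    binary `|` \bigcup_(a in [set a : 'I_k | 1 <= a]) binary_then a) <->
  forall a, 2 <= a -> binary_then a `<=` R.
Proof.
move=> /right_idealP Rid big; split=> [H a a2 x ax|H x [Rx xmin]].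
  have [w /ideal_code_prefix[p Cp]] := cofinal_ext x big.
  move=> /prefix_comparable[] /prefixP[v E].
    by rewrite E; apply: Rid; case: Cp.
  have nb := binary_thenP a2 ax.
  have [Rp _] := Cp; case: (H _ Cp) => [|[b _ [t bt]]].
    by rewrite E => /binary_cat[].
  case/lastP: v E => [|v c] E tE; first by rewrite -(cats0 x) -E.
  move: tE; rewrite E -rcons_cat => /rcons_inj[tE _].
  by move: bt; rewrite tE => /binary_cat[].
have [bx|/not_binary[u [a [v [a2 bu xE]]]]] := pselect (binary x); first by left.
right; exists a; first exact: ltnW.
have au : binary_then a (rcons u a) by exists u.
by rewrite -(xmin (rcons u a)) //; [exact: (H a)|rewrite xE prefix_prefix].
Qed.

(* An equivalent form of the defining conditions of the subgroup, more
   convenient to check. *)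
Lemma separatingP g : RIfin g -> separating g <->
  [/\ forall a, 2 <= a -> binary_then a `<=` Dom g,
      forall a, 2 <= a -> binary_then a `<=` Im g &
      forall x y, g x = Some y -> (binary x <-> binary y) /\
        forall a, 2 <= a -> (binary_then a x <-> binary_then a y)].
Proof.
move=> /RIfinP[gM gI gD gR].
rewrite /separating subUset (ideal_code_binary (Dom_ideal gM) gD).
rewrite (ideal_code_binary (Im_ideal gM) gR).
by split=> [[[]]|[]].
Qed.

Lemma separating_Some : separating Some.
Proof.
apply/separatingP; first exact: Some_RIfin.
split=> [a _ x _|a _ x _|x _ [<-]] //; by exists x.
Qed.

Lemma separating_pinv g : RIfin g -> separating g -> separating (pinv g).
Proof.
move=> /[dup] gR /RIfinP[_ gI _ _] /(separatingP gR)[gD gIm g2].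
apply/separatingP; first exact: pinv_RIfin.
split=> [a a2 y /(gIm _ a2)[x gx]|a a2 x /(gD _ a2)[y gx]|y x].
- by exists x; apply/pinvE.
- by exists y; apply/pinvE.
move=> /pinvE-/(_ gI)/g2[H1 H2]; split=> [|a a2]; split.
- by move/H1.
- by move/H1.
- by move/(H2 _ a2).
- by move/(H2 _ a2).
Qed.

Lemma separating_pcomp f g : RIfin f -> RIfin g ->
  separating f -> separating g -> separating (pcomp f g).
Proof.
move=> fR gR /(separatingP fR)[fD fI f2] /(separatingP gR)[gD gI g2].
apply/separatingP; first exact: pcomp_RIfin.
split=> [a a2 x ax|a a2 z az|x z /pcompE[y gx fy]].
- have [y gx] := gD a a2 x ax; have [_ /(_ a a2)[+ _]] := g2 _ _ gx.
  by move=> /(_ ax)/(fD a a2)[z fy]; exists z; apply/pcompE; exists y.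
- have [y fy] := fI a a2 z az; have [_ /(_ a a2)[_ +]] := f2 _ _ fy.
  by move=> /(_ az)/(gI a a2)[x gx]; exists x; apply/pcompE; exists y.
have [b1 t1] := g2 _ _ gx; have [b2 t2] := f2 _ _ fy.
split=> [|a a2]; first exact: (iff_trans b1 b2).
exact: (iff_trans (t1 a a2) (t2 a a2)).
Qed.

Lemma separating_maximum_extension f :
  RIfin f -> separating f -> separating (maximum_extension f).
Proof.
move=> fR /(separatingP fR)[fD fI f2].
have [hR sub _] := maximum_extensionP fR; have /RIfinP[hM hI _ _] := hR.
apply/(separatingP hR).
split=> [a a2 x /(fD a a2)[y fx]|a a2 y /(fI a a2)[x fx]|x y hx].
- by exists y; exact: sub.
- by exists x; exact: sub.
split=> [|a a2]; last (split=> [ax|ay]).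
- have [n H] := (maximum_extensionE x y fR).1 hx.
  have [->//|[w [bw nw]]] : x = y \/ exists w, binary w /\ n <= size w.
    have [->|[[|b w] nw]] := long_word n x y; [by left|by right; exists [::]|].
    have k0 : 0 < k by apply: leq_ltn_trans (ltn_ord b).
    right; exists (nseq n (Ordinal k0)); rewrite size_nseq.
    by split=> //; rewrite /binary /= all_nseq orbT.
  have [+ _] := f2 _ _ (H _ nw).
  rewrite !binary_cat => -[H1 H2]; split=> b.
    by have [] := H1 (conj b bw).
  by have [] := H2 (conj b bw).
- have [z fx] := fD a a2 x ax.
  move: hx; rewrite (sub _ _ fx) => -[<-].
  by have [_ /(_ a a2)[+ _]] := f2 _ _ fx; apply.
- have [z fz] := fI a a2 y ay.
  have <- : z = x by apply: hI hx; exact: sub.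
  by have [_ /(_ a a2)[_ +]] := f2 _ _ fz; apply.
Qed.

Definition HT_separating : {pred HT k} :=
  [pred g : HT k | `[< separating g >]].

Lemma HT_separating_group_closed : group_closed HT_separating.
Proof.
split=> [|f g /asboolP fS /asboolP gS]; apply/asboolP.
  exact: separating_Some.
apply: separating_maximum_extension.
  by apply: pcomp_RIfin; exact: HT_RIfin.
apply: separating_pcomp => //; try exact: HT_RIfin.
apply: separating_maximum_extension; first by apply/pinv_RIfin/HT_RIfin.
by apply: separating_pinv => //; exact: HT_RIfin.
Qed.

(* The group G_{k,1}(0,1|2|...|k-1). *)
Record HTsep := MkHTsep {
  HTsep_val :> HT k;
  HTsep_valP : HTsep_val \in HT_separating
}.

HB.instance Definition _ := [isSub for HTsep_val].
HB.instance Definition _ := [Choice of HTsep by <:].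
HB.instance Definition _ :=
  SubChoice_isSubGroup.Build (HT k) HT_separating HTsep
    HT_separating_group_closed.

End Subgroup.

(* Main.v *)
Require Import Defs.
From HB Require Import structures.
From mathcomp Require Import all_boot.
From mathcomp Require Import boolp classical_sets.

(** Through [u |-> u 1 0 0 0 ...] the set {a_0,a_1}^* is identified with the
    dyadic points of the Cantor space other than 0 0 0 ..., and G_{2,1} permutes
    the dyadic points. Moving a copy of G_{2,1} into the cone of a_1 makes it fix
    0 0 0 ..., so that it acts by permutations on {a_0,a_1}^*; this action and
    the original partial one agree on every word in the domain. An element g of
    that copy is then extended to words [u a v] with [u] binary and [a = a_i],
    i >= 2, by letting g permute the [u]'s. *)

Set Implicit Arguments.
Unset Strict Implicit.
Unset Printing Implicit Defensive.

Local Open Scope classical_set_scope.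

(** * Partial functions from single-valued relations *)

Section GraphPfun.
Variables (k : nat) (R : word k -> word k -> Prop).

Definition graph_pfun : pfun k :=
  fun x => if pselect (exists y, R x y) is left e
           then Some (projT1 (cid e)) else None.

Lemma graph_pfunE x y : (forall y1 y2, R x y1 -> R x y2 -> y1 = y2) ->
  graph_pfun x = Some y <-> R x y.
Proof.
move=> Rf; rewrite /graph_pfun; case: pselect => [e|ne].
  by case: cid => z /= Rz; split=> [[<-]|Ry] //; rewrite (Rf _ _ Rz Ry).
by split=> // Ry; case: ne; exists y.
Qed.

End GraphPfun.

(** * Inverses and domains in [RIfin] *)

Section Inverses.
Variable k : nat.
Implicit Types f g : pfun k.

Lemma pinvK f : pinjective f -> pinv (pinv f) = f.
Proof.
move=> fI; apply: pfun_ext => x y; rewrite pinvE; first exact: pinvE.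
by move=> y1 y2 z /(pinvE _ _ fI) E1 /(pinvE _ _ fI) E2; move: E1; rewrite E2 => -[].
Qed.

(** A converse graph makes [f] injective and turns its image into the domain of [g]. For [cone] and
    [lift], the same construction applied to the inverse serves as [g]. *)
Lemma RIfin_inverse f g : right_ideal_morphism f ->
  cofinal (Dom f) -> cofinal (Dom g) ->
  (forall x y, f x = Some y <-> g y = Some x) -> RIfin f.
Proof.
move=> fM fD gD fg; apply/RIfinP; split=> //.
  by move=> x1 x2 y /fg E1 /fg; rewrite E1 => -[].
have -> // : Im f = Dom g.
by rewrite eqEsubset; split=> y [x /fg H]; exists x.
Qed.

Lemma cofinal_Dom f : RIfin f -> cofinal (Dom f).
Proof. by case/RIfinP. Qed.

Lemma RIfin_morphism f : RIfin f -> right_ideal_morphism f.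
Proof. by case/RIfinP. Qed.

Lemma RIfin_inj f : RIfin f -> pinjective f.
Proof. by case/RIfinP. Qed.

Lemma eventually_defined f : RIfin f ->
  exists n, forall x, n <= size x -> exists y, f x = Some y.
Proof. by case/cofinal_Dom. Qed.

End Inverses.

(** * Words as names of dyadic points *)

Section DyadicWords.
Implicit Types u v w x y : word 2.

Definition zeros n : word 2 := nseq n ord0.
Definition one_zeros n : word 2 := ord_max :: zeros n.

Lemma zerosD n m : zeros (n + m) = zeros n ++ zeros m.
Proof. exact: nseqD. Qed.

Lemma one_zerosD n m : one_zeros (n + m) = one_zeros n ++ zeros m.
Proof. by rewrite /one_zeros zerosD. Qed.

Lemma ord2P (a : 'I_2) : a = ord0 \/ a = ord_max.
Proof. by case: a => -[|[|//]] i; [left|right]; apply: val_inj. Qed.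

(** The last one marks where the prefix ends; after reversal it becomes the first one, and
    everything up to it cancels. *)
Lemma one_zeros_inj u v n m : u ++ one_zeros n = v ++ one_zeros m -> u = v.
Proof.
have aux i j (s t : word 2) :
    zeros i ++ ord_max :: s = zeros j ++ ord_max :: t -> s = t.
  by elim: i j => [|i IH] [|j] //= [] //; exact: IH.
move=> /(congr1 rev); rewrite !rev_cat !rev_cons !rev_nseq !cat_rcons => /aux.
exact: (can_inj revK).
Qed.

Lemma zeros_neq_one_zeros u n m : zeros n <> u ++ one_zeros m.
Proof.
move=> E; have : (ord_max : 'I_2) \in zeros n.
  by rewrite E mem_cat mem_head orbT.
by rewrite mem_nseq andbF.
Qed.

Lemma dyadic_word x :
  x = zeros (size x) \/ exists v m, x = v ++ one_zeros m.
Proof.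
elim: x => [|a x [E|[v [m ->]]]]; first by left.
  have [->|->] := ord2P a; first by left; rewrite {1}E.
  by right; exists [::], (size x); rewrite {1}E.
by right; exists (a :: v), m.
Qed.

End DyadicWords.

(** * The action on dyadic points *)

Section DyadicMove.
Implicit Types (f g : pfun 2) (u v w x y : word 2).

(** For a right ideal morphism this means being the identity on all extensions of [zeros n], which
    is stronger than fixing the point 0 0 0 ... *)
Definition fixes_zero f := exists n, f (zeros n) = Some (zeros n).

(* u stands for the dyadic point u 1 0 0 0 ... *)
Definition dyadic_move f u v :=
  exists n m, f (u ++ one_zeros n) = Some (v ++ one_zeros m).

Lemma one_zeros_pad f u v n m d : right_ideal_morphism f ->
  f (u ++ one_zeros n) = Some (v ++ one_zeros m) ->
  f (u ++ one_zeros (n + d)) = Some (v ++ one_zeros (m + d)).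
Proof. by move=> fM /fM/(_ (zeros d)); rewrite -!catA -!one_zerosD. Qed.

Lemma dyadic_move_fun f u v1 v2 : right_ideal_morphism f ->
  dyadic_move f u v1 -> dyadic_move f u v2 -> v1 = v2.
Proof.
move=> fM [n1 [m1 E1]] [n2 [m2 E2]].
have := one_zeros_pad n1 fM E2; rewrite addnC (one_zeros_pad n2 fM E1).
by case=> /one_zeros_inj.
Qed.

Lemma dyadic_move_contained f u v :
  right_ideal_morphism f -> f u = Some v -> dyadic_move f u v.
Proof. by move=> fM /fM E; exists 0, 0; exact: E. Qed.

Lemma dyadic_move_cat f u v w : right_ideal_morphism f ->
  f u = Some v -> dyadic_move f (u ++ w) (v ++ w).
Proof. by move=> fM /fM/(_ w); exact: dyadic_move_contained. Qed.

(** A long enough padding of [u] enters the domain. If its image had only zeros, further padding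
    would make that image also the image of a word of zeros, against injectivity. *)
Lemma dyadic_move_total f u : RIfin f -> fixes_zero f ->
  exists v, dyadic_move f u v.
Proof.
move=> fR [l f0]; have [N H] := eventually_defined fR.
have fM := RIfin_morphism fR.
have [y fy] : exists y, f (u ++ one_zeros N) = Some y.
  by apply: H; rewrite size_cat /= size_nseq -addSnnS leq_addl.
have [E|[v [m E]]] := dyadic_word y; last by exists v, N, m; rewrite -E.
(* The [l] extra zeros make the output long enough to be a word fixed by [f]. *)
have : f (u ++ one_zeros (N + l)) = Some (zeros (l + size y)).
  by rewrite one_zerosD catA (fM _ _ fy) {1}E -zerosD addnC.
have : f (zeros (l + size y)) = Some (zeros (l + size y)).
  by rewrite zerosD; exact: fM.
by move=> /(RIfin_inj fR) H1 /H1 /zeros_neq_one_zeros.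
Qed.

Lemma dyadic_move_comp f g u v w :
  right_ideal_morphism f -> right_ideal_morphism g ->
  dyadic_move g u v -> dyadic_move f v w -> dyadic_move (pcomp f g) u w.
Proof.
(* Padding the move of [g] by [n2] and that of [f] by [m1] makes them meet in one middle word. *)
move=> fM gM [n1 [m1 E1]] [n2 [m2 E2]]; exists (n1 + n2), (m2 + m1).
apply/pcompE; exists (v ++ one_zeros (m1 + n2)); first exact: one_zeros_pad.
by rewrite addnC; exact: one_zeros_pad.
Qed.

Lemma dyadic_move_pinv f u v : pinjective f ->
  dyadic_move (pinv f) v u <-> dyadic_move f u v.
Proof.
move=> fI; split=> -[n [m E]]; exists m, n; first exact/(pinvE _ _ fI).
exact/pinvE.
Qed.

Lemma dyadic_move_agree f g u v : right_ideal_morphism f ->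
  agree f g -> dyadic_move f u v -> dyadic_move g u v.
Proof.
move=> fM [N fg] [n [m E]]; exists (n + N), (m + N); rewrite -fg.
  exact: one_zeros_pad.
by rewrite size_cat /= size_nseq -addSn addnA leq_addl.
Qed.

Lemma fixes_zero_pinv f : pinjective f -> fixes_zero f -> fixes_zero (pinv f).
Proof. by move=> fI [n fn]; exists n; apply/pinvE. Qed.

End DyadicMove.

(** * Transfer into the cone of a_1 *)

Section Cone.
Implicit Types (f g : pfun 2) (u v w x y : word 2).

(** The empty word stays outside the domain even for [f = Some], so [cone f] need not be its own
    maximum extension when [f] is. *)
Definition cone f : pfun 2 := fun x =>
  if x is a :: w then omap (cons a) ((if a == ord0 then Some else f) w)
  else None.

Lemma cone0 f w : cone f (ord0 :: w) = Some (ord0 :: w). Proof. by []. Qed.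

Lemma cone1 f w : cone f (ord_max :: w) = omap (cons ord_max) (f w).
Proof. by []. Qed.

Lemma cone_pinv f x y : pinjective f ->
  cone f x = Some y -> cone (pinv f) y = Some x.
Proof.
move=> fI; case: x => [//|a w]; have [->|->] := ord2P a.
  by rewrite cone0 => -[<-].
rewrite cone1; case E: (f w) => [v|//] [<-]; rewrite cone1.
by have -> : pinv f v = Some w by apply/pinvE.
Qed.

Lemma cone_morphism f : right_ideal_morphism f -> right_ideal_morphism (cone f).
Proof.
move=> fM [//|a x] y; have [->|->] := ord2P a; first by rewrite cone0 => -[<-].
by rewrite cone1; case E: (f x) => [v|//] [<-] w; rewrite cat_cons cone1 (fM _ _ E).
Qed.

Lemma cofinal_cone f : RIfin f -> cofinal (Dom (cone f)).
Proof.
move=> /eventually_defined[n H]; split; last by exists [:: ord0], [:: ord0].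
exists n.+1 => -[//|a x]; have [->|->] := ord2P a; first by exists (ord0 :: x).
by rewrite ltnS => /H[y E]; exists (ord_max :: y); rewrite cone1 E.
Qed.

Lemma cone_RIfin f : RIfin f -> RIfin (cone f).
Proof.
move=> fR; have fI := RIfin_inj fR.
have fR' := pinv_RIfin fR; apply: (@RIfin_inverse _ _ (cone (pinv f))).
- exact/cone_morphism/RIfin_morphism.
- exact: cofinal_cone.
- exact: cofinal_cone.
move=> x y; split; first exact: cone_pinv.
by move=> /(cone_pinv (RIfin_inj fR')); rewrite pinvK.
Qed.

(** The reason for passing to the cone: the one-letter word a_0 is now fixed. *)
Lemma cone_fixes_zero f : fixes_zero (cone f). Proof. by exists 1. Qed.

Lemma cone_comp f g : cone (pcomp f g) = pcomp (cone f) (cone g).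
Proof.
apply: funext => -[//|a x]; have [->|->] := ord2P a; first by [].
by rewrite cone1 /pcomp cone1; case: (g x).
Qed.

(** Left to right serves multiplicativity of the embedding, right to left its injectivity. *)
Lemma cone_agree f g : agree f g <-> agree (cone f) (cone g).
Proof.
split=> -[n H].
  exists n.+1 => -[//|a w]; have [->|->] := ord2P a; first by [].
  by rewrite ltnS => /H E; rewrite !cone1 E.
exists n => w nw; have := H (ord_max :: w) (leqW nw); rewrite !cone1.
by case: (f w) (g w) => [u|] [v|] //= [->].
Qed.

End Cone.

(** * Extension of binary maps to A_k^* *)

Section Lift.
Variables (k : nat) (k2 : 2 <= k).
Implicit Types (f g : pfun 2) (u v : word 2) (a : 'I_k) (w x y : word k).

Definition emb u : word k := map (widen_ord k2) u.

Lemma emb_inj : injective emb.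
Proof. by apply: inj_map => a b /(congr1 val) /= /val_inj. Qed.

Lemma emb_cat u v : emb (u ++ v) = emb u ++ emb v.
Proof. exact: map_cat. Qed.

Lemma binary_emb u : binary (emb u).
Proof. by rewrite /binary /= all_map; apply/allP => a _ /=. Qed.

Lemma binaryP x : binary x -> exists u, x = emb u.
Proof.
rewrite /binary /=; elim: x => [|a x IH]; first by exists [::].
move=> /= /andP[a2 /IH[u ->]]; exists (Ordinal a2 :: u); congr (_ :: _).
exact: val_inj.
Qed.

Lemma lift_cases x :
  (exists u, x = emb u) \/ exists u a w, 2 <= a /\ x = emb u ++ a :: w.
Proof.
have [/binaryP|/not_binary[u [a [w [a2 /binaryP[u' ->] ->]]]]] := pselect (binary x).
  by left.
by right; exists u', a, w; rewrite cat_rcons.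
Qed.

Lemma nonbinary_cat u a w : 2 <= a -> ~ binary (emb u ++ a :: w).
Proof. by move=> a2 /binary_cat[_]; rewrite /binary /= ltnNge a2. Qed.

(** The first letter of index at least 2 determines the splitting. *)
Lemma emb_cat_inj u v a (b : 'I_k) w w' : 2 <= a -> 2 <= b ->
  emb u ++ a :: w = emb v ++ b :: w' -> [/\ u = v, a = b & w = w'].
Proof.
move=> a2 b2; elim: u v => [|c u IH] [|d v] //=.
- by case.
- by case=> E; move: a2; rewrite E /= leqNgt ltn_ord.
- by case=> E; move: b2; rewrite -E /= leqNgt ltn_ord.
- by case=> /val_inj -> /IH[-> -> ->].
Qed.

Lemma binary_then_cat u a (b : 'I_k) w : 2 <= a -> 2 <= b ->
  binary_then b (emb u ++ a :: w) <-> a = b /\ w = [::].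
Proof.
move=> a2 b2; split=> [[_ /binaryP[v ->]]|[<- ->]].
  by rewrite -cats1 => /esym/emb_cat_inj[].
by exists (emb u); rewrite ?cats1 //; exact: binary_emb.
Qed.

(** The second rule does not ask for [f u] to be defined. Thus, when dyadic moves are total, every
    nonbinary word enters the domain, as the subgroup requires of {a_0,a_1}^* a_i. *)
Variant lift_graph f : word k -> word k -> Prop :=
| LiftBinary u v : f u = Some v -> lift_graph f (emb u) (emb v)
| LiftNonbinary u v a w : 2 <= a -> dyadic_move f u v ->
    lift_graph f (emb u ++ a :: w) (emb v ++ a :: w).

Lemma lift_graph_binary f u y :
  lift_graph f (emb u) y -> exists2 v, f u = Some v & y = emb v.
Proof.
move E: (emb u) => x H; case: H E => [u' v fu /emb_inj->|].
  by exists v.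
move=> u' v a w a2 _ E; case: (@nonbinary_cat u' a w a2); rewrite -E.
exact: binary_emb.
Qed.

Lemma lift_graph_nonbinary f u a w y : 2 <= a ->
  lift_graph f (emb u ++ a :: w) y ->
  exists2 v, dyadic_move f u v & y = emb v ++ a :: w.
Proof.
move=> a2; move E: (emb u ++ a :: w) => x H.
case: H E => [u' v _ E|u' v b w' b2 fu /(emb_cat_inj a2 b2)[-> -> ->]].
  by case: (@nonbinary_cat u a w a2); rewrite E; exact: binary_emb.
by exists v.
Qed.

Definition lift f : pfun k := graph_pfun (lift_graph f).

Lemma liftE f x y : right_ideal_morphism f ->
  lift f x = Some y <-> lift_graph f x y.
Proof.
move=> fM; apply: graph_pfunE => y1 y2.
have [[u ->]|[u [a [w [a2 ->]]]]] := lift_cases x.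
  move=> /lift_graph_binary[v1 E1 ->] /lift_graph_binary[v2 + ->].
  by rewrite E1 => -[->].
move=> /(lift_graph_nonbinary a2)[v1 E1 ->].
by move=> /(lift_graph_nonbinary a2)[v2 /(dyadic_move_fun fM E1) -> ->].
Qed.

Lemma lift_binary f u : right_ideal_morphism f -> lift f (emb u) = omap emb (f u).
Proof.
move=> fM; case E: (f u) => [v|] /=; first by apply/liftE => //; left.
case E': (lift _ _) => [y|//]; move/liftE: E' => /(_ fM)/lift_graph_binary[v].
by rewrite E.
Qed.

Lemma lift_morphism f : right_ideal_morphism f -> right_ideal_morphism (lift f).
Proof.
move=> fM x y /(liftE _ _ fM) xy w; apply/(liftE _ _ fM).
case: xy => [u v fu|u v a w' a2 uv]; last by rewrite -!catA /=; right.
have [[t ->]|[t [a [w' [a2 ->]]]]] := lift_cases w.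
  by rewrite -!emb_cat; left; exact: fM.
(* Appending [w] passes from the first rule to the second; they are compatible because
   [f u = Some v] moves [u ++ t] to [v ++ t]. *)
by rewrite !catA -!emb_cat; right=> //; exact: dyadic_move_cat.
Qed.

Lemma lift_pinv f x y : RIfin f ->
  lift f x = Some y <-> lift (pinv f) y = Some x.
Proof.
move=> fR; have fI := RIfin_inj fR.
rewrite !liftE; [|exact/RIfin_morphism/pinv_RIfin|exact: RIfin_morphism].
split=> -[u v fu|u v a w a2 fu]; [left|right|left|right] => //.
- exact/pinvE.
- exact/dyadic_move_pinv.
- exact/(pinvE _ _ fI).
- exact/(dyadic_move_pinv _ _ fI).
Qed.

Lemma cofinal_lift f : RIfin f -> fixes_zero f -> cofinal (Dom (lift f)).
Proof.
move=> fR f0; have fM := RIfin_morphism fR; have [n H] := eventually_defined fR.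
have def x : n <= size x -> Dom (lift f) x.
  have [[u ->]|[u [a [w [a2 ->]]]]] := lift_cases x.
    by rewrite size_map => /H[v fu]; exists (emb v); apply/liftE => //; left.
  (* A nonbinary word lies in the domain whatever its length. *)
  have [v uv] := dyadic_move_total u fR f0.
  by exists (emb v ++ a :: w); apply/liftE => //; right.
by split; [exists n|exists (emb (zeros n)); apply: def; rewrite size_map size_nseq].
Qed.

Lemma lift_RIfin f : RIfin f -> fixes_zero f -> RIfin (lift f).
Proof.
move=> fR f0; apply: (@RIfin_inverse _ _ (lift (pinv f))).
- exact/lift_morphism/RIfin_morphism.
- exact: cofinal_lift.
- apply: cofinal_lift; first exact: pinv_RIfin.
  by apply: fixes_zero_pinv => //; exact: RIfin_inj.
- by move=> x y; exact: lift_pinv.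
Qed.

Lemma lift_Dom f a : RIfin f -> fixes_zero f -> 2 <= a ->
  binary_then a `<=` Dom (lift f).
Proof.
move=> fR f0 a2 _ [_ /binaryP[u ->] <-]; have [v uv] := dyadic_move_total u fR f0.
exists (emb v ++ [:: a]); rewrite -cats1.
by apply/liftE; [exact: RIfin_morphism|right].
Qed.

(** The suffix from the first letter beyond a_1 on is preserved, so word types are too. The image
    condition is the domain condition for the lift of the inverse. *)
Lemma lift_separating f : RIfin f -> fixes_zero f -> separating (lift f).
Proof.
move=> fR f0; apply/separatingP; first exact: lift_RIfin.
split=> [a a2|a a2 y ay|x y /(liftE _ _ (RIfin_morphism fR))xy].
- exact: lift_Dom.
- have [x /(lift_pinv _ _ fR)] := lift_Dom (pinv_RIfin fR)
    (fixes_zero_pinv (RIfin_inj fR) f0) a2 ay.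
  by exists x.
case: xy => [u v _|u v b w b2 _]; split=> [|a a2].
- by split=> _; exact: binary_emb.
- by split=> /(binary_thenP a2) []; exact: binary_emb.
- by split=> /(nonbinary_cat b2).
- by rewrite !binary_then_cat.
Qed.

(** The equality is exact: binary words see the partial composition, and on nonbinary words both
    sides are total and compose dyadic moves. *)
Lemma lift_comp f g : RIfin f -> RIfin g -> fixes_zero f -> fixes_zero g ->
  lift (pcomp f g) = pcomp (lift f) (lift g).
Proof.
move=> fR gR f0 g0; have fM := RIfin_morphism fR; have gM := RIfin_morphism gR.
have cM := RIfin_morphism (pcomp_RIfin fR gR).
apply: funext => x; have [[u ->]|[u [a [w [a2 ->]]]]] := lift_cases x.
  rewrite lift_binary // /pcomp lift_binary //.
  by case: (g u) => //= v; rewrite lift_binary.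
have [v uv] := dyadic_move_total u gR g0; have [t vt] := dyadic_move_total v fR f0.
transitivity (Some (emb t ++ a :: w)).
  by apply/liftE => //; right=> //; exact: dyadic_move_comp uv vt.
apply/esym/pcompE; exists (emb v ++ a :: w); by apply/liftE => //; right.
Qed.

(** On nonbinary words the lifts coincide at every length, since padding lets a dyadic move be read
    off from long words. *)
Lemma lift_agree f g : RIfin f -> RIfin g -> fixes_zero f -> agree f g ->
  agree (lift f) (lift g).
Proof.
move=> fR gR f0 /[dup] fg [n H]; exists n => x.
have fM := RIfin_morphism fR; have gM := RIfin_morphism gR.
have [[u ->]|[u [a [w [a2 ->]]]]] := lift_cases x.
  by rewrite size_map => /H E; rewrite !lift_binary // E.
move=> _; have [v uv] := dyadic_move_total u fR f0.
transitivity (Some (emb v ++ a :: w)); first by apply/liftE => //; right.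
by apply/esym/liftE => //; right=> //; exact: dyadic_move_agree fg uv.
Qed.

(** The restriction to binary words is a copy of [f]; injectivity of the embedding comes from
    here. *)
Lemma agree_lift f g : right_ideal_morphism f -> right_ideal_morphism g ->
  agree (lift f) (lift g) -> agree f g.
Proof.
move=> fM gM [n H]; exists n => u nu.
have := H (emb u); rewrite size_map !lift_binary // => /(_ nu).
by case: (f u) (g u) => [v|] [t|] //= [/emb_inj->].
Qed.

(** * The homomorphism into the subgroup *)

Lemma cone_lift_RIfin f : RIfin f -> RIfin (lift (cone f)).
Proof. by move=> fR; apply: lift_RIfin; [exact: cone_RIfin|exact: cone_fixes_zero]. Qed.

Lemma cone_lift_separating f : RIfin f -> separating (lift (cone f)).
Proof.
by move=> fR; apply: lift_separating; [exact: cone_RIfin|exact: cone_fixes_zero].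
Qed.

Definition HT_lift (g : HT 2) : HT k :=
  MkHT (maximum_extension_HT (cone_lift_RIfin (HT_RIfin g))).

Lemma HT_lift_separating (g : HT 2) : HT_lift g \in @HT_separating k.
Proof.
apply/asboolP/separating_maximum_extension; first exact/cone_lift_RIfin/HT_RIfin.
exact/cone_lift_separating/HT_RIfin.
Qed.

Definition HTsep_lift (g : HT 2) : HTsep k := MkHTsep (HT_lift_separating g).

Lemma HT_lift_agree (g : HT 2) : agree (HT_lift g) (lift (cone g)).
Proof. exact/agree_maximum_extension/cone_lift_RIfin/HT_RIfin. Qed.

Lemma HT_mul_agree n (f g : HT n) : agree (f * g)%g (pcomp f g).
Proof. by apply/agree_maximum_extension/pcomp_RIfin; exact: HT_RIfin. Qed.

(** By [HT_eq] only long words matter, and there a maximum extension may be replaced by the function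
    it extends. *)
Lemma HTsep_liftM : {morph HTsep_lift : f g / (f * g)%g >-> (f * g)%g}.
Proof.
move=> f g; apply: val_inj; apply: HT_eq.
have cR (h : HT 2) := cone_RIfin (HT_RIfin h).
apply: (agree_trans (HT_lift_agree (f * g)%g)).
apply: (@agree_trans _ _ (lift (cone (pcomp f g)))).
  apply: lift_agree; [exact: cR| |exact: cone_fixes_zero|].
    by apply/cone_RIfin/pcomp_RIfin; exact: HT_RIfin.
  exact/(cone_agree _ _).1/HT_mul_agree.
rewrite cone_comp lift_comp; try exact: cR; try exact: cone_fixes_zero.
apply/agree_sym/(agree_trans (HT_mul_agree (HT_lift f) (HT_lift g))).
by apply: agree_pcomp; [exact: HT_RIfin|exact: HT_lift_agree|exact: HT_lift_agree].
Qed.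

Lemma HTsep_lift_inj : injective HTsep_lift.
Proof.
move=> f g /(congr1 (@HTsep_val k)) /= E; apply/HT_eq/(cone_agree _ _).2.
have cM (h : HT 2) := RIfin_morphism (cone_RIfin (HT_RIfin h)).
apply: agree_lift => //; apply/(agree_trans (agree_sym (HT_lift_agree f))).
by rewrite E; exact: HT_lift_agree.
Qed.

HB.instance Definition _ :=
  isMultiplicative.Build (HT 2) (HTsep k) HTsep_lift HTsep_liftM.

End Lift.

Theorem lemma2p9 (k : nat) (hk : 3 <= k) :
  exists iota : {multiplicative HT 2 -> HTsep k}, injective iota.
Proof.
by exists (HTsep_lift (ltnW hk)); exact: HTsep_lift_inj.
Qed.
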